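(* Let $k\in[n]$ and $t=k/n$. For any two-block packing instance satisfying relatively complete recourse, $$\Big(2+\frac{1}{t-2}\Big)\cdot\mathrm{OPT}\ \le\ \mathrm{DUAL}^M_k\ \le\ \mathrm{OPT}.$$
   Context: $[n]=\{1,\dots,n\}$; $\mathbf{conv}$ denotes convex hull; $\min$ is read as infimum in the extended reals ($+\infty$ over the empty set). Two-block problem. For $i\in\{1,2\}$ let $$\mathcal{X}^{(i)}=\{(x^{(i)},y^{(i)}): A^{(i)}x^{(i)}+B^{(i)}y^{(i)}\le b^{(i)},\ y^{(i)}\ge 0 \text{ mixed-integer},\ x^{(i)}\in\{0,1\}^n\},$$ where ''mixed-integer'' means that a prescribed subset of the coordinates of $y^{(i)}$ is required to be integer, and $A^{(i)},B^{(i)},b^{(i)}$ and the objective vectors $c^{(i)},d^{(i)}$ are rational of suitable dimensions. Let $$\mathrm{OPT}=\min\Big\{\sum_{i\in\{1,2\}}\langle c^{(i)},x^{(i)}\rangle+\langle d^{(i)},y^{(i)}\rangle:\ (x^{(i)},y^{(i)})\in\mathcal{X}^{(i)},\ i\in\{1,2\},\ x^{(1)}=x^{(2)}\Big\}.$$ The instance is packing if all $c^{(i)},d^{(i)}$ are entrywise non-positive and all $A^{(i)},B^{(i)},b^{(i)}$ are entrywise non-negative. Relatively complete recourse: for any $(x^{(1)},y^{(1)})\in\mathcal{X}^{(1)}$ there exists $y^{(2)}$ with $(x^{(1)},y^{(2)})\in\mathcal{X}^{(2)}$, and for any $(x^{(2)},y^{(2)})\in\mathcal{X}^{(2)}$ there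 exists $y^{(1)}$ with $(x^{(2)},y^{(1)})\in\mathcal{X}^{(1)}$. M-Lagrangian dual of level $k$. Let $\mathcal{S}=\binom{[n]}{\le k}$ be the collection of all subsets of $[n]$ of cardinality at most $k$, and $$\mathcal{X}^{(i)}_M(\mathcal{S})=\Big\{(x^{(i)},y^{(i)},w^{(i)}):(x^{(i)},y^{(i)})\in\mathcal{X}^{(i)},\ w^{(i)}_S=\prod_{j\in S}x^{(i)}_j\ \ \forall S\in\mathcal{S}\Big\}.$$ The value of the Lagrangian dual obtained by dualizing the constraints $w^{(1)}_S=w^{(2)}_S$, $S\in\mathcal{S}$, is given by its primal characterization $$\mathrm{DUAL}^M_k=\min\Big\{\sum_{i\in\{1,2\}}\langle c^{(i)},x^{(i)}\rangle+\langle d^{(i)},y^{(i)}\rangle:\ (x^{(i)},y^{(i)},w^{(i)})\in\mathbf{conv}\{\mathcal{X}^{(i)}_M(\mathcal{S})\},\ i\in\{1,2\},\ w^{(1)}_S=w^{(2)}_S\ \forall S\in\mathcal{S}\Big\}.$$ *)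

(* Defs.v *)
From mathcomp Require Import all_boot all_order all_algebra.
From mathcomp Require Import all_classical all_reals ereal.

Set Implicit Arguments.
Unset Strict Implicit.
Unset Printing Implicit Defensive.

Import Order.TTheory GRing.Theory Num.Theory.

Local Open Scope classical_set_scope.
Local Open Scope ring_scope.

(* One block of a two-block problem: rational data for minimising
   <c, x> + <d, y> subject to A x + B y <= b with x binary and y >= 0
   mixed-integer. The coordinates of y in [intvar] are the integer ones;
   the number of rows and the dimension of y may differ between blocks. *)
Record block (n : nat) := Block {
  rows : nat;
  ydim : nat;
  Amx : 'M[rat]_(rows, n);
  Bmx : 'M[rat]_(rows, ydim);
  bvec : 'cV[rat]_rows;
  cvec : 'cV[rat]_n;
  dvec : 'cV[rat]_ydim;
  intvar : {set 'I_ydim} }.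

Definition dotr (R : realType) (m : nat) (u : 'cV[rat]_m) (v : 'cV[R]_m) : R :=
  \sum_(j < m) ratr (u j 0) * v j 0.

Definition feasible (R : realType) (n : nat) (P : block n) :
    set ('cV[R]_n * 'cV[R]_(ydim P)) :=
  [set z | [/\ forall i, (map_mx ratr (Amx P) *m z.1
                          + map_mx ratr (Bmx P) *m z.2) i 0
                         <= ratr (bvec P i 0),
               forall j, 0 <= z.2 j 0,
               forall j, j \in intvar P -> z.2 j 0 \is a Num.int
             & forall j, z.1 j 0 = 0 \/ z.1 j 0 = 1]].

Arguments feasible {R n} P _.

Definition cost (R : realType) (n : nat) (P : block n)
    (z : 'cV[R]_n * 'cV[R]_(ydim P)) : R :=
  dotr (cvec P) z.1 + dotr (dvec P) z.2.

Arguments cost {R n} P z.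

Definition OPT (R : realType) (n : nat) (P1 P2 : block n) : \bar R :=
  ereal_inf [set v | exists (z1 : 'cV[R]_n * 'cV[R]_(ydim P1))
                            (z2 : 'cV[R]_n * 'cV[R]_(ydim P2)),
    [/\ feasible P1 z1, feasible P2 z2, z1.1 = z2.1
      & v = (cost P1 z1 + cost P2 z2)%:E]].

Definition packing_block (n : nat) (P : block n) : Prop :=
  [/\ forall j, cvec P j 0 <= 0,
      forall j, dvec P j 0 <= 0,
      forall i j, 0 <= Amx P i j,
      forall i j, 0 <= Bmx P i j
    & forall i, 0 <= bvec P i 0].

Definition packing (n : nat) (P1 P2 : block n) : Prop :=
  packing_block P1 /\ packing_block P2.

Definition relatively_complete_recourse (R : realType) (n : nat)
    (P1 P2 : block n) : Prop :=
  (forall x (y1 : 'cV[R]_(ydim P1)), feasible P1 (x, y1) ->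
     exists y2 : 'cV[R]_(ydim P2), feasible P2 (x, y2)) /\
  (forall x (y2 : 'cV[R]_(ydim P2)), feasible P2 (x, y2) ->
     exists y1 : 'cV[R]_(ydim P1), feasible P1 (x, y1)).

Definition conv_hull (R : realType) (E : lmodType R) (X : set E) : set E :=
  [set z | exists (N : nat) (lam : 'I_N -> R) (v : 'I_N -> E),
    [/\ forall j, 0 <= lam j, \sum_(j < N) lam j = 1,
        forall j, X (v j) & z = \sum_(j < N) lam j *: v j]].

Definition lowset (n k : nat) : finType := {S : {set 'I_n} | (#|S| <= k)%N}.

Definition lifted (R : realType) (n p k : nat) : lmodType R :=
  ('cV[R]_n * 'cV[R]_p * {ffun lowset n k -> R^o})%type.

Definition feasibleM (R : realType) (n k : nat) (P : block n) :
    set (lifted R n (ydim P) k) :=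
  [set z : lifted R n (ydim P) k | feasible P z.1 /\
     forall S : lowset n k, z.2 S = \prod_(j in val S) z.1.1 j 0].

Arguments feasibleM {R n} k P _.

Definition DUALM (R : realType) (n k : nat) (P1 P2 : block n) : \bar R :=
  ereal_inf [set v | exists (z1 : lifted R n (ydim P1) k)
                            (z2 : lifted R n (ydim P2) k),
    [/\ conv_hull (feasibleM k P1) z1, conv_hull (feasibleM k P2) z2,
        forall S : lowset n k, z1.2 S = z2.2 S
      & v = (cost P1 z1.1 + cost P2 z2.1)%:E]].

(* Main.v *)
(** Write the cost of a dual solution as C + G, where C is the contribution
    of the common mean xbar of x1 and x2 and G that of y1 and y2.
    Completing each point of either hull decomposition by recourse in the
    other block, whose y-cost is nonpositive, gives 2 OPT <= 2 C + G.
    Next let T be a k-subset carrying at least its share t = k/n of C.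
    Agreement of the moments of order at most k makes x1 and x2 equal in
    distribution on T, so they can be coupled to agree there; setting the
    coordinates outside T to 0 keeps a packing block feasible with y
    unchanged, hence OPT <= t C + G.  The two bounds, weighted by
    (1 - t) / (2 - t) and 1 / (2 - t), give the claim. *)

Require Import Defs.
From mathcomp Require Import all_boot all_order all_algebra.
From mathcomp Require Import all_classical all_reals ereal.
From mathcomp Require Import ring lra.

Set Implicit Arguments.
Unset Strict Implicit.
Unset Printing Implicit Defensive.

Import Order.TTheory GRing.Theory Num.Theory.

Local Open Scope ring_scope.

(** * Averaging over subsets, moments and couplings *)

(** Start from [U] and repeatedly discard an element of largest weight; the average of what remains
    never increases. *)
Lemma exists_subset_sum_le_average (R : realFieldType) (I : finType)
    (w : I -> R) (U : {set I}) (k : nat) : (k <= #|U|)%N ->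
  exists T : {set I}, #|T| = k /\
    #|U|%:R * \sum_(i in T) w i <= k%:R * \sum_(i in U) w i.
Proof.
move=> /subnKC; move: (#|U| - k)%N => m; elim: m k => [|m IHm] k.
  by rewrite addn0 => ->; exists U.
rewrite addnS -addSn => /IHm[T [cT leT]].
have /card_gt0P[i0 i0T] : (0 < #|T|)%N by rewrite cT.
have [i iT maxi] : exists2 i, i \in T & forall j, j \in T -> w j <= w i.
  by case: (arg_maxP w i0T) => i; exists i.
exists (T :\ i); split.
  by apply/eqP; rewrite -eqSS -cT (cardsD1 i T) iT.
have le_wi : \sum_(j in T) w j <= k.+1%:R * w i.
  rewrite -cT mulr_natl -sumr_const; apply: ler_sum => j jT; exact: maxi.
move: le_wi leT; rewrite (big_setD1 i iT) /=.
set s := \sum_(j in T :\ i) w j; set S := \sum_(j in U) w j => le_wi leT.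
have kpos : 0 < k.+1%:R :> R by rewrite ltr0n.
have U0 : 0 <= #|U|%:R :> R by rewrite ler0n.
(* After scaling by [k + 1], the goal follows from [k] times the induction hypothesis ([h1]) and the
   fact that [w i] is at least the average of the other [k] weights ([h2]). *)
rewrite -(ler_pM2l kpos).
have k0 : 0 <= k%:R :> R by rewrite ler0n.
have eqk : k.+1%:R = k%:R + 1 :> R by rewrite -natr1.
rewrite eqk in le_wi leT kpos *.
have h1 := ler_wpM2l k0 leT.
have h2 : #|U|%:R * s <= #|U|%:R * (k%:R * w i) by apply: ler_wpM2l => //; lra.
nra.
Qed.

(** Moebius inversion on the subsets of [T], by induction from large [p] to small: the moment at [p]
    is the mass of the trace [p] plus the masses of strictly larger traces, which already agree. *)
Lemma eq_mass_of_eq_moments (R : numDomainType) (I J L : finType)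
    (lam : J -> R) (mu : L -> R) (A : J -> {set I}) (B : L -> {set I})
    (T : {set I}) :
  (forall S : {set I}, S \subset T ->
     \sum_(j | S \subset A j) lam j = \sum_(l | S \subset B l) mu l) ->
  forall p : {set I},
     \sum_(j | T :&: A j == p) lam j = \sum_(l | T :&: B l == p) mu l.
Proof.
move=> eq_mom p.
have [m] := ubnP (#|~: p|); elim: m p => // m IHm p; rewrite ltnS => lepm.
have [pT|npT] := boolP (p \subset T); last first.
  rewrite !big1 // => j /eqP pE; move: npT; rewrite -pE finset.subsetIl //.
(* Since [p] lies in [T], it is contained in [D j] exactly when it is contained in the trace of
   [D j] on [T], so the moment can be grouped by traces. *)
have split_mom (K : finType) (nu : K -> R) (D : K -> {set I}) :
    \sum_(j | p \subset D j) nu j =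
    \sum_(j | T :&: D j == p) nu j
    + \sum_(q : {set I} | p \proper q) \sum_(j | T :&: D j == q) nu j.
  rewrite (partition_big (fun j => T :&: D j) (fun q => p \subset q)) /=; last first.
    by move=> j pD; rewrite finset.subsetI pT.
  rewrite (bigD1 p) //=; congr (_ + _).
    apply: eq_bigl => j; case: eqP => [<-|]; last by rewrite andbF.
    by rewrite finset.subsetIr.
  apply: eq_big => [q|q /andP[pq _]]; first by rewrite finset.properEneq andbC eq_sym.
  apply: eq_bigl => j; case: eqP => [E|]; last by rewrite andbF.
  by rewrite (fintype.subset_trans pq) // -E finset.subsetIr.
have := eq_mom _ pT; rewrite !split_mom.
rewrite (eq_bigr (fun q : {set I} => \sum_(l | T :&: B l == q) mu l)); first by move/addIr.
move=> q pq; apply: IHm; apply: leq_trans lepm.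
by apply: proper_card; rewrite finset.properC.
Qed.

(** Draw the common label first, then the two indices independently given that label. *)
Lemma exists_coupling (R : numFieldType) (K : eqType) (J L : finType)
    (lam : J -> R) (mu : L -> R) (r : J -> K) (s : L -> K) :
  (forall j, 0 <= lam j) -> (forall l, 0 <= mu l) ->
  (forall a, \sum_(j | r j == a) lam j = \sum_(l | s l == a) mu l) ->
  exists pi : J -> L -> R,
    [/\ forall j l, 0 <= pi j l,
        forall j l, r j != s l -> pi j l = 0,
        forall j, \sum_l pi j l = lam j
      & forall l, \sum_j pi j l = mu l].
Proof.
move=> lam0 mu0 eq_mass.
pose mass a := \sum_(j | r j == a) lam j.
have mass0 a : 0 <= mass a by apply: sumr_ge0.
(* A label of mass zero is harmless: division by zero returns 0, and every weight with that label is
   itself 0, being a nonnegative term of a vanishing sum. *)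
have massK (M : finType) (nu : M -> R) (q : M -> K) (i : M) :
    (forall i, 0 <= nu i) -> (forall a, mass a = \sum_(m | q m == a) nu m) ->
    nu i * mass (q i) / mass (q i) = nu i.
  move=> nu0 massE; have [m0|m0] := eqVneq (mass (q i)) 0; last by rewrite mulfK.
  rewrite m0 mulr0 mul0r; move/eqP: m0; rewrite massE.
  by rewrite psumr_eq0 // => /allP/(_ i (mem_index_enum i)); rewrite eqxx => /eqP ->.
exists (fun j l => if r j == s l then lam j * mu l / mass (r j) else 0).
split=> [j l|j l /negPf -> //|j|l].
- by case: ifP => // _; rewrite divr_ge0 // mulr_ge0.
- rewrite -big_mkcond /= -mulr_suml -mulr_sumr.
  rewrite (eq_bigl (fun l => s l == r j)) => [|l]; last by rewrite eq_sym.
  by rewrite -eq_mass; apply: massK.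
- rewrite -big_mkcond /= (eq_bigr (fun j => mu l * lam j / mass (s l))).
    by rewrite -mulr_suml -mulr_sumr; apply: massK.
  by move=> j /eqP ->; rewrite (mulrC (mu l)).
Qed.

(** * Costs, binary vectors and feasibility in one block *)

Section Blocks.
Variables (R : realType) (n : nat).
Implicit Type P : block n.

Lemma dotr_sum m (u : 'cV[rat]_m) N (lam : 'I_N -> R) (v : 'I_N -> 'cV[R]_m) :
  dotr u (\sum_(j < N) lam j *: v j) = \sum_(j < N) lam j * dotr u (v j).
Proof.
rewrite /dotr (eq_bigr (fun i => \sum_(j < N) lam j * (ratr (u i 0) * v j i 0))).
  by rewrite exchange_big; apply: eq_bigr => j _; rewrite mulr_sumr.
move=> i _; rewrite summxE mulr_sumr; apply: eq_bigr => j _.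
by rewrite mxE mulrCA.
Qed.

Lemma dotr_le0 m (u : 'cV[rat]_m) (v : 'cV[R]_m) :
  (forall i, u i 0 <= 0) -> (forall i, 0 <= v i 0) -> dotr u v <= 0.
Proof.
by move=> u0 v0; apply: sumr_le0 => i _; rewrite mulr_le0_ge0 // lerq0.
Qed.

Definition supp (x : 'cV[R]_n) : {set 'I_n} := [set i | x i 0 == 1].
Definition ind (A : {set 'I_n}) : 'cV[R]_n := \col_i (i \in A)%:R.

Lemma binaryE (x : 'cV[R]_n) i :
  (forall i, x i 0 = 0 \/ x i 0 = 1) -> x i 0 = (i \in supp x)%:R.
Proof.
by move=> /(_ i)[] xi; rewrite inE xi ?eqxx // eq_sym oner_eq0.
Qed.

Lemma prod_binary (x : 'cV[R]_n) (S : {set 'I_n}) :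
  (forall i, x i 0 = 0 \/ x i 0 = 1) ->
  \prod_(i in S) x i 0 = (S \subset supp x)%:R.
Proof.
move=> xbin; have [/fintype.subsetP sub|/subsetPn[i iS ix]] := boolP (S \subset supp x).
  by rewrite big1 // => i iS; rewrite binaryE // sub.
by rewrite (bigD1 i) //= binaryE // (negPf ix) mul0r.
Qed.

Lemma dotr_indI (u : 'cV[rat]_n) (T : {set 'I_n}) (x : 'cV[R]_n) :
  (forall i, x i 0 = 0 \/ x i 0 = 1) ->
  dotr u (ind (T :&: supp x)) = \sum_(i in T) ratr (u i 0) * x i 0.
Proof.
move=> xbin; rewrite /dotr [RHS]big_mkcond; apply: eq_bigr => i _.
by rewrite mxE finset.in_setI (binaryE i xbin); case: (i \in T); rewrite //= mulr0.
Qed.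

(** Since [Amx P] is nonnegative, lowering coordinates of [x] to 0 can only lower the left-hand
    sides. *)
Lemma feasible_restrict P x y (T : {set 'I_n}) : packing_block P ->
  feasible (R := R) P (x, y) -> feasible P (ind (T :&: supp x), y).
Proof.
move=> [_ _ A0 _ _] [/= leb y0 yint xbin]; split=> //= i; last first.
  by rewrite mxE; case: (_ \in _); [right|left].
apply: le_trans (leb i); rewrite !mxE lerD2r; apply: ler_sum => j _.
rewrite !mxE ler_wpM2l ?ler0q // (binaryE j xbin) finset.in_setI.
by case: (j \in T); rewrite ?lexx ?ler0n.
Qed.

Lemma feasible0 P : packing_block P -> feasible (R := R) P (0, 0).
Proof.
move=> [_ _ _ _ b0]; split=> /= [i|j|j _|j]; last by left; rewrite mxE.
- by rewrite !mulmx0 addr0 mxE ler0q.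
- by rewrite mxE.
- by rewrite mxE rpred0.
Qed.

Lemma OPT_le P1 P2 x y1 y2 : feasible P1 (x, y1) -> feasible P2 (x, y2) ->
  (OPT R P1 P2 <= (cost P1 (x, y1) + cost P2 (x, y2))%:E)%E.
Proof.
by move=> f1 f2; apply: ereal_inf_lbound; exists (x, y1), (x, y2).
Qed.

(** * Hull points as distributions over feasible points *)

(** The multipliers [lam] act as probabilities. A monomial of a binary point indicates that [S] lies
    in its support, so [z.2 S] is the probability that the random support contains [S]. *)
Lemma conv_feasibleM k P z : conv_hull (feasibleM (R := R) k P) z ->
  exists N (lam : 'I_N -> R) (x : 'I_N -> 'cV[R]_n) (y : 'I_N -> 'cV[R]_(ydim P)),
    [/\ (forall j, 0 <= lam j) /\ \sum_j lam j = 1,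
        forall j, feasible P (x j, y j),
        z.1.1 = \sum_j lam j *: x j,
        z.1.2 = \sum_j lam j *: y j
      & forall S : lowset n k,
          z.2 S = \sum_(j | val S \subset supp (x j)) lam j].
Proof.
move=> [N [lam [v [lam0 lam1 vf zE]]]].
exists N, lam, (fun j => (v j).1.1), (fun j => (v j).1.2); split => //.
- by move=> j; have [+ _] := vf j; case: (v j).1.
- by rewrite zE !raddf_sum /=.
- by rewrite zE !raddf_sum /=.
move=> S; rewrite zE raddf_sum /= sum_ffunE [RHS]big_mkcond; apply: eq_bigr => j _.
rewrite ffunE; have [[_ _ _ xbin] ->] := vf j.
by rewrite prod_binary //; case: ifP => _; rewrite ?scaler0 // /GRing.scale /= mulr1.
Qed.


Lemma cost_conv P N (lam : 'I_N -> R) x y :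
  cost P (\sum_j lam j *: x j, \sum_j lam j *: y j) =
  \sum_j lam j * cost P (x j, y j).
Proof.
rewrite /cost /= !dotr_sum -big_split /=.
by apply: eq_bigr => j _; rewrite mulrDr.
Qed.

Lemma le_conv_cost (r : R) P (u : 'cV[rat]_n) N (lam : 'I_N -> R) x y :
  (forall j, 0 <= lam j) -> \sum_j lam j = 1 ->
  (forall j, r <= cost P (x j, y j) + dotr u (x j)) ->
  r <= cost P (\sum_j lam j *: x j, \sum_j lam j *: y j)
       + dotr u (\sum_j lam j *: x j).
Proof.
move=> lam0 lam1 ler; rewrite cost_conv dotr_sum -big_split /=.
rewrite -[r]mul1r -lam1 mulr_suml; apply: ler_sum => j _.
by rewrite -mulrDr ler_wpM2l.
Qed.

(** * Lower bounds from recourse and from truncation *)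

Lemma recourse_bound (r : R) P1 P2 x1 y1 y2 : packing_block P2 ->
  (r%:E <= OPT R P1 P2)%E -> feasible P1 (x1, y1) -> feasible P2 (x1, y2) ->
  r <= cost P1 (x1, y1) + dotr (cvec P2) x1.
Proof.
move=> [_ d0 _ _ _] rle f1 f2.
have := le_trans rle (OPT_le f1 f2); rewrite lee_fin {2}/cost /= => rle'.
have [_ y20 _ _] := f2.
have := dotr_le0 d0 y20 => /=; lra.
Qed.

Lemma OPTC P1 P2 : OPT R P1 P2 = OPT R P2 P1.
Proof.
congr ereal_inf; apply/seteqP; split=> v [z1 [z2 [f1 f2 e ->]]];
  by exists z2, z1; rewrite addrC.
Qed.

(** Each pair charged by the coupling has a common trace on [T]; truncated to it, the pair is
    feasible for the joint problem and costs at least [r]. The right-hand side is the average of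
    these truncated costs. *)
Lemma truncation_bound (r : R) P1 P2 (T : {set 'I_n})
    N1 (lam : 'I_N1 -> R) x1 y1 N2 (mu : 'I_N2 -> R) x2 y2 :
  packing_block P1 -> packing_block P2 -> (r%:E <= OPT R P1 P2)%E ->
  (forall j, 0 <= lam j) -> \sum_j lam j = 1 -> (forall l, 0 <= mu l) ->
  (forall j, feasible P1 (x1 j, y1 j)) -> (forall l, feasible P2 (x2 l, y2 l)) ->
  (forall S : {set 'I_n}, S \subset T ->
     \sum_(j | S \subset supp (x1 j)) lam j
     = \sum_(l | S \subset supp (x2 l)) mu l) ->
  r <= \sum_(i in T) ratr (cvec P1 i 0) * (\sum_j lam j *: x1 j) i 0
       + \sum_(i in T) ratr (cvec P2 i 0) * (\sum_l mu l *: x2 l) i 0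
       + dotr (dvec P1) (\sum_j lam j *: y1 j)
       + dotr (dvec P2) (\sum_l mu l *: y2 l).
Proof.
move=> pack1 pack2 rle lam0 lam1 mu0 f1 f2 /eq_mass_of_eq_moments eq_mass.
have [pi [pi0 piE pi1 pi2]] := exists_coupling lam0 mu0 eq_mass.
have restricted P N (nu : 'I_N -> R) x y : (forall j, feasible P (x j, y j)) ->
    \sum_(i in T) ratr (cvec P i 0) * (\sum_j nu j *: x j) i 0
    + dotr (dvec P) (\sum_j nu j *: y j) =
    \sum_j nu j * cost P (ind (T :&: supp (x j)), y j).
  move=> f; rewrite /cost dotr_sum (eq_bigr (fun i => \sum_j nu j *
    (ratr (cvec P i 0) * x j i 0))); last first.
    move=> i _; rewrite summxE mulr_sumr; apply: eq_bigr => j _.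
    by rewrite mxE mulrCA.
  rewrite exchange_big -big_split /=; apply: eq_bigr => j _.
  by have [_ _ _ xbin] := f j; rewrite dotr_indI // mulrDr -mulr_sumr.
rewrite -addrA addrACA !restricted //.
(* Both block costs become sums over pairs weighted by [pi], so the comparison with [r] can be made
   pair by pair. *)
under eq_bigr => j _ do rewrite -pi1 mulr_suml.
under [X in _ + X]eq_bigr => l _ do rewrite -pi2 mulr_suml.
rewrite [X in _ + X]exchange_big -big_split /=.
rewrite -[r]mul1r -lam1 mulr_suml; apply: ler_sum => j _.
rewrite -pi1 mulr_suml -big_split /=; apply: ler_sum => l _.
rewrite -mulrDr.
have [E|/piE ->] := eqVneq (T :&: supp (x1 j)) (T :&: supp (x2 l)); last first.
  by rewrite !mul0r.
rewrite ler_wpM2l // -lee_fin; apply: le_trans rle _.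
rewrite E; apply: OPT_le; last exact: feasible_restrict.
by rewrite -E; apply: feasible_restrict.
Qed.

(** * Upper and lower bounds on the dual value *)

(** A feasible point with its own monomials is a one-point convex combination, and a shared [x]
    gives shared monomials. *)
Lemma DUALM_le_OPT k P1 P2 : (DUALM R k P1 P2 <= OPT R P1 P2)%E.
Proof.
apply/ereal_infP => v [z1 [z2 [f1 f2 eqx ->]]]; apply: ereal_inf_lbound.
pose lift p (z : 'cV[R]_n * 'cV[R]_p) : lifted R n p k :=
  (z, [ffun S : lowset n k => \prod_(j in val S) z.1 j 0]).
have liftP P z : feasible P z -> conv_hull (feasibleM k P) (lift _ z).
  move=> f; exists 1%N, (fun=> 1), (fun=> lift _ z); split=> //.
  - by rewrite big_ord1.
  - by move=> _; split=> // S; rewrite ffunE.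
  - by rewrite big_ord1 scale1r.
exists (lift _ z1), (lift _ z2); split; [exact: liftP | exact: liftP | | by []].
by move=> S; rewrite !ffunE eqx.
Qed.

(** A real lower bound [r] stands in for the extended real [OPT], which keeps the argument within
    real arithmetic. *)
Lemma DUALM_ge (r t : R) k P1 P2 : (1 <= k <= n)%N -> t = k%:R / n%:R ->
  packing P1 P2 -> relatively_complete_recourse R P1 P2 ->
  (r%:E <= OPT R P1 P2)%E ->
  (((2 + 1 / (t - 2)) * r)%:E <= DUALM R k P1 P2)%E.
Proof.
move=> /andP[k1 kn] tE [pack1 pack2] [rec12 rec21] rle.
apply/ereal_infP => v [z1 [z2 [/conv_feasibleM H1 /conv_feasibleM H2 eqw ->]]].
move: H1 H2 => [N1 [lam [x1 [y1 [[lam0 lam1] f1 ex1 ey1 ew1]]]]].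
move=> [N2 [mu [x2 [y2 [[mu0 mu1] f2 ex2 ey2 ew2]]]]].
have eq_mom (S : {set 'I_n}) : (#|S| <= k)%N ->
    \sum_(j | S \subset supp (x1 j)) lam j = \sum_(l | S \subset supp (x2 l)) mu l.
  by move=> Sk; have := eqw (exist _ S Sk); rewrite ew1 ew2.
have meanE P N (nu : 'I_N -> R) x y i : (forall j, feasible P (x j, y j)) ->
    (\sum_j nu j *: x j) i 0 = \sum_(j | [set i] \subset supp (x j)) nu j.
  move=> f; rewrite summxE [RHS]big_mkcond; apply: eq_bigr => j _.
  have [_ _ _ xbin] := f j.
  by rewrite mxE (binaryE i xbin) finset.sub1set; case: ifP; rewrite ?mulr1 ?mulr0.
(* As [k] is at least 1, the singleton moments agree, and these are the coordinates of the means. *)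
have eq_mean : \sum_j lam j *: x1 j = \sum_l mu l *: x2 l.
  apply/colP => i; rewrite (meanE _ _ _ _ _ _ f1) (meanE _ _ _ _ _ _ f2).
  by rewrite eq_mom // cards1.
set xbar := \sum_j lam j *: x1 j in ex1 eq_mean.
have bound1 : r <= cost P1 z1.1 + dotr (cvec P2) xbar.
  rewrite (surjective_pairing z1.1) ex1 ey1; apply: le_conv_cost => // j.
  by have [y' fy'] := rec12 _ _ (f1 j); apply: recourse_bound rle (f1 j) fy'.
have bound2 : r <= cost P2 z2.1 + dotr (cvec P1) xbar.
  rewrite (surjective_pairing z2.1) ex2 ey2 eq_mean; apply: le_conv_cost => // l.
  have [y' fy'] := rec21 _ _ (f2 l).
  by rewrite OPTC in rle; apply: recourse_bound rle (f2 l) fy'.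
(* [w i] is the joint cost of coordinate [i] at the common mean; the chosen [T] has total at most
   [t] times the whole. *)
pose w i := (ratr (cvec P1 i 0) + ratr (cvec P2 i 0)) * xbar i 0.
have [|T [cT leT]] := @exists_subset_sum_le_average R _ w [set: 'I_n] k.
  by rewrite cardsT card_ord.
have bound3 : r <= \sum_(i in T) w i
    + dotr (dvec P1) z1.1.2 + dotr (dvec P2) z2.1.2.
  have := @truncation_bound r P1 P2 T _ lam x1 y1 _ mu x2 y2 pack1 pack2 rle
            lam0 lam1 mu0 f1 f2.
  rewrite -eq_mean -ey1 -ey2 -/xbar -big_split /=.
  under eq_bigr => i _ do rewrite -mulrDl.
  by apply=> S ST; apply: eq_mom; rewrite -cT subset_leq_card.
have sumw : \sum_(i in [set: 'I_n]) w i = dotr (cvec P1) xbar + dotr (cvec P2) xbar.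
  rewrite -big_split /=; apply: eq_big => [i|i _]; first by rewrite inE.
  by rewrite /w mulrDl.
rewrite cardsT card_ord sumw in leT.
have n0 : 0 < n%:R :> R by rewrite ltr0n (leq_trans k1).
have {}leT : \sum_(i in T) w i <= t * (dotr (cvec P1) xbar + dotr (cvec P2) xbar).
  by rewrite -(ler_pM2l n0) mulrA tE mulrCA divff ?gt_eqF // mulr1.
have t1 : t <= 1 by rewrite tE ler_pdivrMr // mul1r ler_nat.
rewrite lee_fin.
move: bound1 bound2 bound3; rewrite /cost ex1 ex2 -eq_mean.
set C1 := dotr (cvec P1) xbar in leT *; set C2 := dotr (cvec P2) xbar in leT *.
set G1 := dotr (dvec P1) _; set G2 := dotr (dvec P2) _; move=> b1 b2 b3.
have t2 : 0 < 2 - t by lra.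
have -> : 2 + 1 / (t - 2) = (3 - 2 * t) / (2 - t).
  by field; rewrite !subr_eq0; apply/andP; split; [rewrite gt_eqF|rewrite lt_eqF]; lra.
rewrite mulrAC ler_pdivrMr //.
(* With C = [C1 + C2] and G = [G1 + G2], adding [b3] and the bound on the sum over [T] gives
   [(3 - 2 * t) * r] at most [(2 - t) * (C + G)]. *)
have b12 : (1 - t) * (r + r) <= (1 - t) * ((C1 + G1 + C2) + (C2 + G2 + C1)).
  by rewrite ler_wpM2l ?lerD //; lra.
lra.
Qed.

Lemma OPT_le0 P1 P2 : packing P1 P2 -> (OPT R P1 P2 <= 0)%E.
Proof.
move=> [pack1 pack2].
apply: le_trans (OPT_le (feasible0 pack1) (feasible0 pack2)) _.
have dotr0 m (u : 'cV[rat]_m) : dotr u (0 : 'cV[R]_m) = 0.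
  by apply: big1 => i _; rewrite mxE mulr0.
by rewrite /cost !dotr0 !addr0.
Qed.

End Blocks.

Theorem theorem3 (R : realType) (n k : nat) (hk : (1 <= k <= n)%N)
    (P1 P2 : block n) (hpack : packing P1 P2)
    (hrec : relatively_complete_recourse R P1 P2) :
  let t : R := k%:R / n%:R in
  ((2 + 1 / (t - 2))%:E * OPT R P1 P2 <= DUALM R k P1 P2)%E /\
  (DUALM R k P1 P2 <= OPT R P1 P2)%E.
Proof.
move=> t; split; last exact: DUALM_le_OPT.
have := OPT_le0 R hpack; have := fun r => @DUALM_ge R n r t k P1 P2 hk erefl hpack hrec.
(* The value [+oo] is excluded because [OPT] is at most 0. *)
case: (OPT R P1 P2) => [r|//|] bound _; first by rewrite -EFinM bound.
have t1 : t <= 1.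
  have /andP[k1 kn] := hk.
  by rewrite ler_pdivrMr ?mul1r ?ler_nat // ltr0n (leq_trans k1).
(* When [OPT] is [-oo], this makes the factor at least 1, hence positive, so the product is
   [-oo]. *)
have ti : (2 - t)^-1 <= 1 by rewrite invf_le1; lra.
rewrite mulrNy gtr0_sg ?mul1e ?leNye //.
by rewrite -opprB invrN mulrN mul1r; lra.
Qed.
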